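(* Let $f:\mathbb{R}\to\mathbb{R}$ be of bounded variation on $[-\infty,\infty]$ and let $f\in L^1(\mathbb{R})$. Let $\hat f(s)=\int_{-\infty}^{\infty}e^{-ist}f(t)\,dt$ for $s\in\mathbb{R}$. Then for each $x\in\mathbb{R}$, $$\frac{f(x-)+f(x+)}{2}=\frac{1}{2\pi}\lim_{T\to\infty}\int_{-T}^{T}e^{ixs}\hat f(s)\,ds.$$
   Context: $f(x-)$ and $f(x+)$ denote the left and right limits of $f$ at $x$. A function $f$ is of bounded variation on $[-\infty,\infty]$ if the sums $\sum_{n=1}^N|f(x_n)-f(x_{n-1})|$ are bounded over all partitions $-\infty=x_0<x_1<\dots<x_N=\infty$, where $f(\pm\infty)$ denotes $\lim_{t\to\pm\infty}f(t)$. *)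

(* Defs.v *)
From mathcomp Require Export all_boot all_order all_algebra complex.
From mathcomp Require Export all_classical all_reals all_analysis.

Set Implicit Arguments.
Unset Strict Implicit.
Unset Printing Implicit Defensive.

Import Order.TTheory GRing.Theory Num.Theory.
Import numFieldTopology.Exports numFieldNormedType.Exports.

Local Open Scope classical_set_scope.
Local Open Scope ring_scope.
Local Open Scope complex_scope.

(* [lim] is a total operator. In [bounded_variation_bar] its two values are
   genuine limits: bounding the sums over the finite partition points alone
   already forces f to converge at both infinities. *)
Definition ext_bar {R : realType} (f : R -> R) (y : \bar R) : R :=
  match y with
  | r%:E => f r
  | +oo%E => lim (f t @[t --> +oo])
  | -oo%E => lim (f t @[t --> -oo])
  end.

(* For [itv_partition -oo +oo s], the points x_0 < x_1 < ... < x_N are the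
   entries of [-oo :: s], with N = size s and x_N = +oo. *)
Definition variation_bar {R : realType} (f : R -> R) (s : seq (\bar R)) : R :=
  let x := nth +oo%E (-oo%E :: s) in
  \sum_(1 <= n < (size s).+1) `|ext_bar f (x n) - ext_bar f (x n.-1)|.

Definition bounded_variation_bar {R : realType} (f : R -> R) : Prop :=
  has_ubound [set variation_bar f s | s in @itv_partition _ (\bar R) -oo%E +oo%E].

Definition expi {R : realType} (a : R) : R[i] := cos a +i* sin a.

(* The library's Lebesgue integral is real-valued: integrate the real and
   imaginary parts separately. *)
Definition cintegral {R : realType} (D : set R) (g : R -> R[i]) : R[i] :=
  (\int[lebesgue_measure]_(t in D) complex.Re (g t))
  +i* (\int[lebesgue_measure]_(t in D) complex.Im (g t)).

Definition fourier {R : realType} (f : R -> R) (s : R) : R[i] :=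
  cintegral setT (fun t => expi (- (s * t)) * (f t)%:C).

(* The topology is attached to the copy [R[i]^o] of [R[i]], given by the
   modulus. *)
Definition fourier_partial {R : realType} (f : R -> R) (x T : R) : R[i]^o :=
  cintegral `[- T, T] (fun s => expi (x * s) * fourier f s).

(* Main.v *)
Require Import Defs.
From mathcomp Require Import measurable_realfun ring lra.

Import Order.TTheory GRing.Theory Num.Theory.
Import numFieldTopology.Exports numFieldNormedType.Exports.

Local Open Scope classical_set_scope.
Local Open Scope ring_scope.
Local Open Scope complex_scope.

Set Implicit Arguments.
Unset Strict Implicit.

(** The Dirichlet-Jordan theorem. By Fubini, the truncated inversion integral
    is real and equals twice the integral of [f t * D_T (t - x)], where
    [D_T w = sin (T w) / w] is the Dirichlet kernel ([fourier_partialE]).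
    The claim becomes: this integral tends to [pi / 2 * (f(x-) + f(x+))]
    ([dirichlet_jordan]).

    An antiderivative of [D_T] is the sine integral [Si (T w)]. It is bounded
    by 4, and at distance at least [r] from the origin it is within
    [2 / (T r)] of [pi / 2] or [- pi / 2], depending on the side. The last
    fact ([sine_integral_dist], which contains the value of the Dirichlet
    integral) comes from writing [1 / s] as the integral of [exp (- s y)] and
    exchanging the integrals.

    Three error terms then have to be small. Far from [x] the kernel is at
    most [1 / A], and [f] is integrable. Near [x], write [f] as a step
    function, with values [f(x-)] and [f(x+)], plus a remainder [h] that
    vanishes at [x] and whose variation around [x] is as small as desired; the
    step function contributes [(f(x-) + f(x+)) Si (T A)]. For the remainder,
    the second mean value inequality ([second_mean_value_le]) bounds the
    integral of [h k] by the supremum of an antiderivative of [k] times the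
    variation and the boundary values of [h]. Around [x] the antiderivative
    [Si] is bounded and [h] has small variation; on either side [h] has
    bounded variation and [Si] minus its limit is small. *)

Local Notation mu := lebesgue_measure.

(** * Integrals over intervals and primitives *)

Lemma bounded_integrable_itv (R : realType) (i : interval R) (f : R -> R)
    (K : R) :
  (mu [set` i] < +oo)%E -> measurable_fun [set` i] f ->
  (forall x, x \in i -> `|f x| <= K) -> mu.-integrable [set` i] (EFin \o f).
Proof.
move=> ifin mf fK; apply: measurable_bounded_integrable => //.
exists K; split; first exact: num_real.
by move=> M /ltW KM x /= xi; rewrite (le_trans (fK _ xi)).
Qed.

Lemma lebesgue_measure_itv_lty (R : realType) (a b : R) (x y : bool) :
  (mu [set` Interval (BSide x a) (BSide y b)] < +oo)%E.
Proof.
by rewrite lebesgue_measure_itv /=; case: ifP => _; rewrite ?ltry// -EFinB ltry.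
Qed.

Lemma lebesgue_measure_bounded_itv (R : realType) (a b : R) (x y : bool) :
  a <= b ->
  lebesgue_measure ([set` Interval (BSide x a) (BSide y b)] : set R) =
  (b - a)%:E.
Proof.
move=> ab; rewrite lebesgue_measure_itv /= lte_fin; case: ifPn => [//|] /=.
rewrite -leNgt => ba; congr EFin; apply/eqP.
by rewrite eq_sym subr_eq0 eq_le ab ba.
Qed.

Lemma is_derive_continuous (R : realType) (F f : R -> R) :
  (forall x : R, is_derive x 1 F (f x)) -> continuous F.
Proof.
move=> dF x; apply: differentiable_continuous.
by apply/derivable1_diffP; exact: (@ex_derive _ _ _ _ _ _ _ (dF x)).
Qed.

Lemma continuous_integrable_itv (R : realType) (f : R -> R) (a b : R) :
  continuous f -> mu.-integrable `[a, b] (EFin \o f).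
Proof.
move=> cf; apply: continuous_compact_integrable; first exact: segment_compact.
exact: continuous_subspaceT.
Qed.

Lemma Rintegral_derive (R : realType) (F f : R -> R) (a b : R) : a <= b ->
  (forall x : R, is_derive x 1 F (f x)) -> continuous f ->
  \int[mu]_(t in `[a, b]) f t = F b - F a.
Proof.
rewrite le_eqVlt => /predU1P[<- _ _|ab dF cf].
  by rewrite set_itv1 Rintegral_set1 subrr.
have cF := is_derive_continuous dF.
rewrite /Rintegral (@continuous_FTC2 _ f F)//.
- exact: continuous_subspaceT.
- split; first by move=> x _; exact: (@ex_derive _ _ _ _ _ _ _ (dF x)).
  + exact/cvg_at_right_filter/cF.
  + exact/cvg_at_left_filter/cF.
- by move=> x _; rewrite derive1E; exact: (@derive_val _ _ _ _ _ _ _ (dF x)).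
Qed.

Lemma is_derive_ge0_FTC2y (R : realType) (F f : R -> R) (a l : R) :
  (forall x : R, is_derive x 1 F (f x)) -> continuous f ->
  (forall x, a <= x -> 0 <= f x) -> F x @[x --> +oo] --> l ->
  (\int[lebesgue_measure]_(x in `[a, +oo[) (f x)%:E)%E = (l - F a)%:E.
Proof.
move=> dF cf f0 Fl; apply: ge0_continuous_FTC2y => //.
- exact: continuous_subspaceT.
- exact/cvg_at_right_filter/(is_derive_continuous dF).
- by move=> x _; rewrite derive1E; exact: (@derive_val _ _ _ _ _ _ _ (dF x)).
Qed.

Lemma integrable_ge0_fin (R : realType) (D : set R) (f : R -> R) (c : R) :
  measurable D -> measurable_fun D f -> (forall x, D x -> 0 <= f x) ->
  (\int[lebesgue_measure]_(x in D) (f x)%:E)%E = c%:E ->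
  mu.-integrable D (EFin \o f).
Proof.
move=> mD mf f0 fc; apply/integrableP; split; first exact/measurable_EFinP.
suff -> : (\int[mu]_(x in D) `|(EFin \o f) x| = c%:E)%E by rewrite ltry.
rewrite -fc; apply: eq_integral => x; rewrite inE => /f0 fx0.
by rewrite /= ger0_norm.
Qed.

Lemma Rintegral_itv_le (R : realType) (f : R -> R) (a b K : R) (x y : bool) :
  a <= b ->
  mu.-integrable [set` Interval (BSide x a) (BSide y b)] (EFin \o f) ->
  (forall t, t \in Interval (BSide x a) (BSide y b) -> `|f t| <= K) ->
  `|\int[mu]_(t in [set` Interval (BSide x a) (BSide y b)]) f t| <= K * (b - a).
Proof.
move=> ab intf fK; apply: le_trans (le_normr_Rintegral _ intf) _ => //.
have := @Rintegral_cst _ _ _ (@lebesgue_measure R) _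
  (measurable_itv (Interval (BSide x a) (BSide y b))) K.
rewrite [X in fine X]lebesgue_measure_bounded_itv//= => <-.
apply: le_Rintegral => //.
- exact: integrable_norm.
- exact: (bounded_integrable_itv (K := `|K|) (lebesgue_measure_itv_lty _ _ _ _)).
Qed.

Lemma integrable_subitv (R : realType) (f : R -> R) (a b c d : R) :
  a <= c -> d <= b ->
  mu.-integrable `[a, b] (EFin \o f) -> mu.-integrable `[c, d] (EFin \o f).
Proof.
move=> ac db; apply: integrableS => //.
by apply: subset_itv; rewrite bnd_simp.
Qed.

Lemma Rintegral_itv_split (R : realType) (f : R -> R) (a b c : R) :
  a <= c -> c <= b ->
  mu.-integrable `[a, b] (EFin \o f) ->
  \int[mu]_(t in `[a, b]) f t =
  \int[mu]_(t in `[a, c]) f t + \int[mu]_(t in `[c, b]) f t.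
Proof.
move=> ac cb intf; apply/eqP; rewrite addrC -subr_eq; apply/eqP.
rewrite Rintegral_itvB ?bnd_simp// Rintegral_itv_obnd_cbnd//.
apply: integrableS intf => //.
by apply: subset_itv; rewrite bnd_simp.
Qed.

(** * Fubini's theorem for real-valued integrals *)

(** The real-valued integral is 0 when the extended one is infinite, so the
    exchange rests on finiteness of the inner integrals: everywhere on [A] by
    the bound [g], and almost everywhere on [B] by Fubini's theorem for
    extended-valued integrals. *)
Lemma Rintegral_Fubini (d1 d2 : measure_display) (T1 : measurableType d1)
    (T2 : measurableType d2) (R : realType)
    (m1 : {sigma_finite_measure set T1 -> \bar R})
    (m2 : {sigma_finite_measure set T2 -> \bar R})
    (A : set T1) (B : set T2) (F : T1 -> T2 -> R) (g : T1 -> R) :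
  measurable A -> measurable B ->
  measurable_fun setT (fun z : T1 * T2 => F z.1 z.2) ->
  m1.-integrable A (EFin \o g) ->
  (forall s, A s -> (\int[m2]_(t in B) `|F s t|%:E <= (g s)%:E)%E) ->
  \int[m1]_(s in A) \int[m2]_(t in B) F s t =
  \int[m2]_(t in B) \int[m1]_(s in A) F s t.
Proof.
move=> mA mB mF ig Fg.
pose h := EFin \o ((fun z : T1 * T2 => F z.1 z.2) \_ (A `*` B)).
have hE s t : h (s, t) = if (s \in A) && (t \in B) then (F s t)%:E else 0%E.
  rewrite /h /= patchE.
  have -> : ((s, t) \in A `*` B) = (s \in A) && (t \in B) by rewrite in_setX.
  by case: ifP.
have hA s : s \in A -> (fun t => h (s, t)) = (EFin \o F s) \_ B.
  by move=> sA; apply/funext => t; rewrite hE sA patchE.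
have hB t : t \in B -> (fun s => h (s, t)) = (EFin \o F^~ t) \_ A.
  by move=> tB; apply/funext => s; rewrite hE tB andbT patchE.
have hA0 s : s \notin A -> (fun t => h (s, t)) = cst 0%E.
  by move=> sA; apply/funext => t; rewrite hE (negbTE sA).
have hB0 t : t \notin B -> (fun s => h (s, t)) = cst 0%E.
  by move=> tB; apply/funext => s; rewrite hE (negbTE tB) andbF.
have mh : measurable_fun setT h.
  apply/measurable_EFinP.
  apply: (measurable_restrictT _ _).1; last exact: measurable_funTS.
  exact: measurableX.
have ih : (m1 \x m2)%E.-integrable setT h.
  apply/integrable12ltyP => //.
  apply: (@le_lt_trans _ _ (\int[m1]_(s in A) `|(EFin \o g) s|)%E); last first.
    by case/integrableP : ig.
  rewrite [leRHS]integral_mkcond; apply: ge0_le_integral => //.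
  - by move=> s _; exact: integral_ge0.
  - apply: (measurable_fun_fubini_tonelli_F (abse \o h)) => //=.
    exact: measurableT_comp.
  - apply: (measurable_restrictT _ _).1 => //; apply: measurableT_comp => //.
    by case/integrableP : ig.
  - move=> s _; rewrite patchE; case: ifPn => sA.
      rewrite -[X in (X <= _)%E]/(\int[m2]_y (abse \o (fun t => h (s, t))) y)%E.
      rewrite (hA _ sA) -restrict_abse -integral_mkcond.
      by rewrite (le_trans (Fg s (set_mem sA)))//= lee_fin ler_norm.
    rewrite -[X in (X <= _)%E]/(\int[m2]_y (abse \o (fun t => h (s, t))) y)%E.
    by rewrite hA0// integral0_eq// => y _ /=; rewrite normr0.
rewrite /Rintegral; congr fine.
transitivity (\int[m1]_s \int[m2]_t h (s, t))%E; last first.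
  have GE : (fun t => \int[m1]_(s in A) (F s t)%:E)%E \_ B = fubini_G m1 h.
    apply/funext => t; rewrite patchE /fubini_G /=; case: ifPn => tB.
      by rewrite (hB _ tB) -integral_mkcond.
    by rewrite (hB0 _ tB) integral0.
  have GE' : (fun t => (fine (\int[m1]_(s in A) (F s t)%:E))%:E) \_ B =
      EFin \o (fine \o fubini_G m1 h).
    by rewrite -GE; apply/funext => t; rewrite /= !patchE; case: ifPn.
  rewrite (Fubini ih) [RHS]integral_mkcond GE'; apply: ae_eq_integral => //.
  - exact: (measurable_fubini_G ih).
  - have mG := measurable_fubini_G ih.
    by apply/measurable_EFinP; exact: measurableT_comp.
  - have := ae_integrable2 ih.
    by apply: filterS => t /integrable_fin_num /fineK /= ->.
rewrite integral_mkcond; apply: eq_integral => s _; rewrite patchE.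
case: ifPn => sA; last by rewrite (hA0 _ sA) integral0.
rewrite (hA _ sA) -integral_mkcond fineK//.
apply: integrable_fin_num => //; apply/integrableP; split.
  apply/measurable_EFinP; apply: measurable_funTS.
  exact: (measurable_fun_pair2 s mF).
by rewrite (le_lt_trans (Fg _ (set_mem sA)))// ltry.
Qed.

(** * The Dirichlet kernel and the sine integral *)

(** The integral form of [sin (T w) / w], which has the right value [T] at
    [w = 0]. *)
Definition dirichlet_kernel (R : realType) (T w : R) : R :=
  \int[mu]_(s in `]0, T]) cos (s * w).

(** The value of the sine integral at [T w]. Integrating over the frequency
    [s], and not over [w], makes its oddness and its translates in [w] visible
    without any change of variables. *)
Definition sine_integral (R : realType) (T w : R) : R :=
  \int[mu]_(s in `]0, T]) (sin (s * w) / s).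

Lemma normr_sin_le (R : realType) (x : R) : `|sin x| <= `|x|.
Proof.
have H (y : R) : 0 <= y -> `|sin y| <= y.
  move=> y0.
  have [c _] : exists2 c : R, c \in `[0, y] & sin y - sin 0 = cos c * (y - 0).
    apply: MVT_segment => //.
    exact/continuous_subspaceT/continuous_sin.
  rewrite sin0 !subr0 => ->; rewrite normrM (ger0_norm y0) ler_piMl//.
  exact: cos_max.
have [x0|x0] := leP 0 x; first by rewrite (ger0_norm x0) H.
by rewrite -normrN -sinN (ltr0_norm x0) H// oppr_ge0 ltW.
Qed.

Lemma continuous_cosM (R : realType) (w : R) :
  continuous (fun s : R => cos (s * w)).
Proof.
by apply: (@is_derive_continuous R _ (fun s => - sin (s * w) * w)) => x;
  apply: is_derive_eq; rewrite scaler0 add0r /GRing.scale /= mulr1.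
Qed.

Lemma continuous_sinM (R : realType) (w : R) :
  continuous (fun s : R => sin (s * w)).
Proof.
by apply: (@is_derive_continuous R _ (fun s => cos (s * w) * w)) => x;
  apply: is_derive_eq; rewrite scaler0 add0r /GRing.scale /= mulr1.
Qed.

(** One odd primitive covers both [w = 0] and [w != 0]. *)
Lemma cosM_primitive (R : realType) (w : R) :
  exists C : R -> R, [/\ forall s : R, is_derive s 1 C (cos (s * w)),
    forall s, C (- s) = - C s & w != 0 -> forall s, C s = sin (s * w) / w].
Proof.
have [->|w0] := eqVneq w 0.
  by exists id; split=> // s; rewrite mulr0 cos0; exact: is_derive_id.
exists (fun s => sin (s * w) / w); split=> //.
  by move=> s; apply: is_derive_eq; rewrite /GRing.scale /=; field.
by move=> s; rewrite mulNr sinN mulNr.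
Qed.

Lemma sinM_primitive (R : realType) (w : R) :
  exists2 C : R -> R, forall s : R, is_derive s 1 C (sin (s * w)) &
    forall s, C (- s) = C s.
Proof.
have [->|w0] := eqVneq w 0.
  exists (cst 0) => // s; rewrite mulr0 sin0; exact: is_derive_cst.
exists (fun s => - cos (s * w) / w).
  by move=> s; apply: is_derive_eq; rewrite /GRing.scale /=; field.
by move=> s; rewrite [- s * w]mulNr cosN.
Qed.

Lemma dirichlet_kernel_itvcc (R : realType) (T w : R) :
  dirichlet_kernel T w = \int[mu]_(s in `[0, T]) cos (s * w).
Proof.
apply: Rintegral_itv_obnd_cbnd.
apply: (integrableS _ _ _
  (continuous_integrable_itv 0 T (@continuous_cosM R w))) => //.
exact: subset_itv_oc_cc.
Qed.

Lemma dirichlet_kernel_sym (R : realType) (T w : R) : 0 <= T ->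
  \int[mu]_(s in `[- T, T]) cos (s * w) = 2 * dirichlet_kernel T w.
Proof.
move=> T0; have [C [dC CN _]] := cosM_primitive w.
have cc := @continuous_cosM R w.
rewrite dirichlet_kernel_itvcc !(Rintegral_derive _ dC)//; last first.
  by rewrite (le_trans _ T0)// oppr_le0.
have : C 0 = 0 by have := CN 0; rewrite oppr0; lra.
by rewrite CN => ->; ring.
Qed.

Lemma Rintegral_sin_sym (R : realType) (T w : R) : 0 <= T ->
  \int[mu]_(s in `[- T, T]) sin (s * w) = 0.
Proof.
move=> T0; have [C dC CN] := sinM_primitive w.
rewrite (Rintegral_derive _ dC) ?CN ?subrr//.
  by rewrite (le_trans _ T0)// oppr_le0.
exact: continuous_sinM.
Qed.

Lemma dirichlet_kernelE (R : realType) (T w : R) : 0 <= T -> w != 0 ->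
  dirichlet_kernel T w = sin (T * w) / w.
Proof.
move=> T0 w0; have [C [dC CN CE]] := cosM_primitive w.
rewrite dirichlet_kernel_itvcc (Rintegral_derive T0 dC).
  by rewrite !CE// mul0r sin0 mul0r subr0.
exact: (@continuous_cosM R w).
Qed.

(** A bound that is not uniform in [T]: it serves to make products with the
    kernel integrable and to start the subdivision argument of
    [second_mean_value_le]. *)
Lemma dirichlet_kernel_le (R : realType) (T w : R) : 0 <= T ->
  `|dirichlet_kernel T w| <= T.
Proof.
move=> T0; rewrite -[leRHS]mul1r -[X in _ * X]subr0; apply: Rintegral_itv_le => //.
  apply: (integrableS _ _ _
    (continuous_integrable_itv 0 T (@continuous_cosM R w))) => //.
  exact: subset_itv_oc_cc.
by move=> s _; exact: cos_max.
Qed.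

Lemma dirichlet_kernel_decay (R : realType) (T w : R) : 0 <= T -> w != 0 ->
  `|dirichlet_kernel T w| <= `|w|^-1.
Proof.
by move=> T0 w0; rewrite dirichlet_kernelE// normrM normfV ler_piMl// sin_max.
Qed.

Lemma measurable_dirichlet_kernel (R : realType) (T : R) : 0 <= T ->
  measurable_fun setT (dirichlet_kernel T).
Proof.
move=> T0; rewrite -(setvU [set 0%R]).
apply/measurable_funU => //; first exact: measurableC.
split; last exact: measurable_fun_set1.
suff : measurable_fun (~` [set (0 : R)]) (fun w : R => sin (w * T) / w).
  apply: eq_measurable_fun => w; rewrite inE => /eqP w0.
  by rewrite dirichlet_kernelE// [T * w]mulrC.
apply: open_continuous_measurable_fun.
  by apply: closed_openC; exact: closed_eq.
move=> w; rewrite inE => /eqP w0; apply: cvgM.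
  exact: (@continuous_sinM R T).
apply: cvgV => //; exact: cvg_id.
Qed.

Lemma measurable_dirichlet_kernel_shift (R : realType) (T x : R) (D : set R) :
  0 <= T -> measurable_fun D (fun t => dirichlet_kernel T (t - x)).
Proof.
move=> T0; apply: measurable_funTS.
apply: (measurableT_comp (measurable_dirichlet_kernel T0)).
exact: measurable_funB.
Qed.

Lemma integrable_dirichlet_kernel (R : realType) (T x a b : R) : 0 <= T ->
  mu.-integrable `[a, b] (EFin \o (fun t => dirichlet_kernel T (t - x))).
Proof.
move=> T0.
apply: (bounded_integrable_itv (K := T) (lebesgue_measure_itv_lty _ _ _ _)).
  exact: measurable_dirichlet_kernel_shift.
by move=> t _; exact: dirichlet_kernel_le.
Qed.

Lemma integrable_mul_dirichlet_kernel (R : realType) (f : R -> R) (T x : R)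
    (D : set R) :
  0 <= T -> measurable D -> mu.-integrable D (EFin \o f) ->
  mu.-integrable D (EFin \o (fun t => f t * dirichlet_kernel T (t - x))).
Proof.
move=> T0 mD fi; apply: (@integrableMl _ _ _ mu D mD (EFin \o f) _ fi).
  exact: measurable_dirichlet_kernel_shift.
exists T; split; first exact: num_real.
by move=> M /ltW TM t _ /=; rewrite (le_trans (dirichlet_kernel_le _ T0)).
Qed.

Lemma measurable_sinM_div (R : realType) (w T : R) :
  measurable_fun `]0, T] (fun s : R => sin (s * w) / s).
Proof.
suff : measurable_fun (`]0, +oo[ : set R) (fun s : R => sin (s * w) / s).
  apply: measurable_funS => //.
  by move=> s /=; rewrite !in_itv /= => /andP[->].
apply: open_continuous_measurable_fun; first exact: interval_open.
move=> s; rewrite inE /= in_itv /= andbT => s0.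
apply: cvgM; first exact: (@continuous_sinM R w).
apply: cvgV; [exact: lt0r_neq0|exact: cvg_id].
Qed.

Lemma normr_sinM_div_le (R : realType) (w s : R) : `|sin (s * w) / s| <= `|w|.
Proof.
have [->|s0] := eqVneq s 0; first by rewrite invr0 mulr0 normr0.
rewrite normrM normfV ler_pdivrMr ?normr_gt0// mulrC -normrM.
exact: normr_sin_le.
Qed.

Lemma integrable_sinM_div (R : realType) (w T : R) :
  mu.-integrable `]0, T] (EFin \o (fun s : R => sin (s * w) / s)).
Proof.
apply: (bounded_integrable_itv (lebesgue_measure_itv_lty _ _ _ _)).
  exact: measurable_sinM_div.
by move=> s _; exact: normr_sinM_div_le.
Qed.

Lemma sine_integralN (R : realType) (T w : R) :
  sine_integral T (- w) = - sine_integral T w.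
Proof.
rewrite -[RHS]mulN1r /sine_integral -RintegralZl//; last exact: integrable_sinM_div.
by apply: eq_Rintegral => s _; rewrite mulrN sinN mulNr mulN1r.
Qed.

Lemma sine_integral_le (R : realType) (T w : R) : 0 <= T ->
  `|sine_integral T w| <= T * `|w|.
Proof.
move=> T0; rewrite mulrC -[X in _ * X]subr0; apply: Rintegral_itv_le => //.
  exact: integrable_sinM_div.
by move=> s _; exact: normr_sinM_div_le.
Qed.

(** Exchanging the integrals, the inner one over [t] has the primitive
    [sin (s * (t - x)) / s]. *)
Lemma Rintegral_dirichlet_kernel (R : realType) (T x c d : R) : 0 <= T -> c <= d ->
  \int[mu]_(t in `[c, d]) dirichlet_kernel T (t - x) =
  sine_integral T (d - x) - sine_integral T (c - x).
Proof.
move=> T0 cd; rewrite /sine_integral -RintegralB//; [|exact: integrable_sinM_div..].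
rewrite (@Rintegral_Fubini _ _ _ _ _ mu mu _ _
  (fun t s => cos (s * (t - x))) (cst T))//.
- apply: eq_Rintegral => s; rewrite inE /= in_itv /= => /andP[s0 _].
  have dF (t : R) :
      is_derive t 1 (fun t => sin (s * (t - x)) / s) (cos (s * (t - x))).
    by apply: is_derive_eq; rewrite /GRing.scale /=; field; rewrite lt0r_neq0.
  rewrite (Rintegral_derive cd dF) ?mulrBl//.
  apply: (@is_derive_continuous _ _ (fun t => - sin (s * (t - x)) * s)) => t.
  apply: is_derive_eq; rewrite /GRing.scale /=; ring.
- apply: (measurableT_comp (continuous_measurable_fun (@continuous_cos R))).
  by apply: measurable_funM => //; apply: measurable_funB.
- by apply: continuous_integrable_itv => ?; exact: cvg_cst.
- move=> t _; rewrite /cst -[X in (_ <= X)%E]mul1e.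
  have H := (@integral_le_bound _ _ _ mu `]0, T]
    (fun s => (cos (s * (t - x)))%:E) 1%E).
  rewrite (le_trans (H _ _ _ _))//.
  + apply/measurable_EFinP; apply: measurable_funTS.
    exact: (continuous_measurable_fun (@continuous_cosM R (t - x))).
  + by apply/aeW => s _; rewrite lee_fin cos_max.
  + by rewrite !mul1e [X in (X <= _)%E]lebesgue_measure_bounded_itv// subr0.
Qed.

(** * The Dirichlet integral *)

Lemma cvgr_expRM (R : realType) (s : R) : 0 < s ->
  expR (- (s * y)) @[y --> +oo] --> (0 : R).
Proof.
move=> s0; apply: (cvg_comp (fun y => s * y) (fun z => expR (- z))).
  exact: gt0_cvgMry.
exact: cvgr_expR.
Qed.

Lemma continuous_expRM (R : realType) (s : R) :
  continuous (fun y : R => expR (- (s * y))).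
Proof.
apply: (@is_derive_continuous R _ (fun y => - s * expR (- (s * y)))) => y.
apply: is_derive_eq; rewrite /GRing.scale /=; ring.
Qed.

Lemma integral_expRM (R : realType) (s : R) : 0 < s ->
  (\int[lebesgue_measure]_(y in `[0%R, +oo[) (expR (- (s * y)))%:E)%E =
  (s^-1)%:E.
Proof.
move=> s0.
have dF (y : R) :
    is_derive y 1 (fun y => - s^-1 * expR (- (s * y))) (expR (- (s * y))).
  apply: is_derive_eq; rewrite /GRing.scale /=; field; exact: lt0r_neq0.
rewrite (is_derive_ge0_FTC2y dF (l := 0)).
- by rewrite mulr0 oppr0 expR0 mulr1 sub0r opprK.
- exact: continuous_expRM.
- by move=> y _; exact: expR_ge0.
- rewrite -[X in _ --> X](mulr0 (- s^-1)).
  by apply: cvgM; [exact: cvg_cst|exact: cvgr_expRM].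
Qed.

Lemma integrable_expRM (R : realType) (s : R) : 0 < s ->
  mu.-integrable `[0, +oo[ (EFin \o (fun y : R => expR (- (s * y)))).
Proof.
move=> s0; apply: integrable_ge0_fin (integral_expRM s0) => //.
apply: measurable_funTS.
exact: (continuous_measurable_fun (@continuous_expRM _ s)).
Qed.

Lemma sqrDsqr_gt0 (R : realType) (w y : R) : 0 < w -> 0 < w ^+ 2 + y ^+ 2.
Proof. by move=> w0; rewrite ltr_wpDr ?sqr_ge0// exprn_gt0. Qed.

Lemma continuous_poisson (R : realType) (w : R) : 0 < w ->
  continuous (fun y : R => w / (w ^+ 2 + y ^+ 2)).
Proof.
move=> w0 y; apply: cvgM; first exact: cvg_cst.
apply: cvgV; first by rewrite lt0r_neq0// sqrDsqr_gt0.
apply: cvgD; [exact: cvg_cst|exact: exprn_continuous].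
Qed.

(** The Poisson kernel of the half plane, with primitive [atan (y / w)]. *)
Lemma integral_poisson (R : realType) (w : R) : 0 < w ->
  (\int[lebesgue_measure]_(y in `[0%R, +oo[) (w / (w ^+ 2 + y ^+ 2))%:E)%E =
  (pi / 2)%:E.
Proof.
move=> w0.
have dF (y : R) :
    is_derive y 1 (fun y => atan (y / w)) (w / (w ^+ 2 + y ^+ 2)).
  apply: is_derive_eq; rewrite /GRing.scale /=; field.
  by rewrite !lt0r_neq0// sqrDsqr_gt0.
rewrite (is_derive_ge0_FTC2y dF (l := pi / 2)).
- by rewrite mul0r atan0 subr0.
- exact: continuous_poisson.
- by move=> y _; rewrite divr_ge0// ltW// sqrDsqr_gt0.
- apply: (cvg_comp (fun y => y / w) atan); last exact: cvgy_atan.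
  by apply: gt0_cvgMly; rewrite ?invr_gt0//; exact: cvg_id.
Qed.

Lemma integrable_poisson (R : realType) (w : R) : 0 < w ->
  mu.-integrable `[0, +oo[ (EFin \o (fun y : R => w / (w ^+ 2 + y ^+ 2))).
Proof.
move=> w0; apply: integrable_ge0_fin (integral_poisson w0) => //.
  apply: measurable_funTS.
  exact: (continuous_measurable_fun (continuous_poisson w0)).
by move=> y _; rewrite divr_ge0// ltW// sqrDsqr_gt0.
Qed.

(** The exponential decay in [T] of the second term is what makes the sine
    integral converge. *)
Lemma Rintegral_sin_expR (R : realType) (T w y : R) : 0 <= T -> 0 < w ->
  \int[mu]_(s in `]0, T]) (sin (s * w) * expR (- (s * y))) =
  w / (w ^+ 2 + y ^+ 2)
  - expR (- (T * y)) *
    ((y * sin (T * w) + w * cos (T * w)) / (w ^+ 2 + y ^+ 2)).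
Proof.
move=> T0 w0; have d0 := lt0r_neq0 (sqrDsqr_gt0 y w0).
have dF (s : R) : is_derive s 1
    (fun s => - (expR (- (s * y)) *
       ((y * sin (s * w) + w * cos (s * w)) / (w ^+ 2 + y ^+ 2))))
    (sin (s * w) * expR (- (s * y))).
  apply: is_derive_eq; rewrite /GRing.scale /=; by field.
have cf : continuous (fun s : R => sin (s * w) * expR (- (s * y))).
  apply: (@is_derive_continuous _ _ (fun s =>
    w * cos (s * w) * expR (- (s * y)) +
    sin (s * w) * (- y * expR (- (s * y))))) => s.
  apply: is_derive_eq; rewrite /GRing.scale /=; ring.
rewrite Rintegral_itv_obnd_cbnd; last first.
  apply: (integrableS _ _ _ (continuous_integrable_itv 0 T cf)) => //.
  exact: subset_itv_oc_cc.
rewrite (Rintegral_derive T0 dF cf) !mul0r oppr0 expR0 sin0 cos0; by field.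
Qed.

(** Replace [1 / s] by the integral of [exp (- s y)] over [y >= 0] and
    exchange the integrals; for fixed [s] the integral of the absolute value
    over [y] is [|sin (s w)| / s <= |w|], so Fubini's theorem applies. *)
Lemma sine_integral_laplace (R : realType) (T w : R) : 0 <= T -> 0 < w ->
  sine_integral T w = \int[mu]_(y in `[0, +oo[)
    (w / (w ^+ 2 + y ^+ 2)
     - expR (- (T * y)) *
       ((y * sin (T * w) + w * cos (T * w)) / (w ^+ 2 + y ^+ 2))).
Proof.
move=> T0 w0; transitivity (\int[mu]_(s in `]0, T]) \int[mu]_(y in `[0, +oo[)
  (sin (s * w) * expR (- (s * y)))).
  apply: eq_Rintegral => s; rewrite inE /= in_itv /= => /andP[s0 _].
  rewrite RintegralZl//; last exact: integrable_expRM.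
  by rewrite /Rintegral integral_expRM.
rewrite (@Rintegral_Fubini _ _ _ _ _ mu mu _ _ _ (cst `|w|))//.
- by apply: eq_Rintegral => y _; exact: Rintegral_sin_expR.
- apply: measurable_funM.
    apply: (measurableT_comp (continuous_measurable_fun (@continuous_sin R))).
    exact: measurable_funM.
  apply: measurableT_comp => //; apply: measurableT_comp => //.
  exact: measurable_funM.
- apply: (bounded_integrable_itv (K := `|w|)
    (lebesgue_measure_itv_lty _ _ _ _)) => //.
  by move=> x _; rewrite normr_id.
- move=> s; rewrite /= in_itv /= => /andP[s0 _].
  under eq_integral do rewrite normrM (ger0_norm (expR_ge0 _)) EFinM.
  rewrite ge0_integralZl//.
  + rewrite [X in (_ * X)%E]integral_expRM// -EFinM lee_fin.
    rewrite -[s^-1]gtr0_norm ?invr_gt0// -normrM.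
    exact: normr_sinM_div_le.
  + apply/measurable_EFinP/measurable_funTS.
    exact: (continuous_measurable_fun (@continuous_expRM _ s)).
Qed.

(** In [sine_integral_laplace] the first term integrates to [pi / 2], and the
    second is at most [2 / w * exp (- T y)] in absolute value. *)
Lemma sine_integral_dist (R : realType) (T w : R) : 0 < T -> 0 < w ->
  `|sine_integral T w - pi / 2| <= 2 / (T * w).
Proof.
move=> T0 w0; rewrite sine_integral_laplace ?(ltW T0)//.
set B := fun y => expR (- (T * y)) *
  ((y * sin (T * w) + w * cos (T * w)) / (w ^+ 2 + y ^+ 2)).
have Ble y : 0 <= y -> `|B y| <= 2 / w * expR (- (T * y)).
  move=> y0; rewrite /B normrM (ger0_norm (expR_ge0 _)) mulrC.
  rewrite ler_wpM2r ?expR_ge0//.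
  have d0 := sqrDsqr_gt0 y w0.
  rewrite normrM normfV (gtr0_norm d0) ler_pdivrMr//.
  apply: (@le_trans _ _ (y + w)).
    rewrite (le_trans (ler_normD _ _))// !normrM (ger0_norm y0) (gtr0_norm w0).
    by apply: lerD; rewrite ler_piMr ?sin_max ?cos_max// ltW.
  (* (y + w) * w <= 2 * (w ^+ 2 + y ^+ 2) *)
  rewrite mulrAC ler_pdivlMr//.
  have := sqr_ge0 (y - w); have := sqr_ge0 w; have := sqr_ge0 y; lra.
have mB : measurable_fun setT B.
  apply: measurable_funM.
    exact: (continuous_measurable_fun (@continuous_expRM _ T)).
  have -> : (fun y => (y * sin (T * w) + w * cos (T * w)) / (w ^+ 2 + y ^+ 2)) =
     (fun y => (y * sin (T * w) + w * cos (T * w)) * w^-1 *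
        (w / (w ^+ 2 + y ^+ 2))).
    by apply/funext => y; rewrite mulrA mulfVK// lt0r_neq0.
  apply: measurable_funM.
    by apply: measurable_funM => //; apply: measurable_funD => //;
      exact: measurable_funM.
  exact: (continuous_measurable_fun (continuous_poisson w0)).
have iE : mu.-integrable `[0, +oo[ (EFin \o (fun y => 2 / w * expR (- (T * y)))).
  by have := integrableZl _ (2 / w) (integrable_expRM T0); exact.
have iB : mu.-integrable `[0, +oo[ (EFin \o B).
  apply: le_integrable iE => //.
    by apply/measurable_EFinP; exact: measurable_funTS.
  move=> y; rewrite /= in_itv /= andbT => y0; rewrite lee_fin.
  by rewrite (le_trans (Ble _ y0))// ler_norm.
rewrite RintegralB//; last exact: integrable_poisson.
rewrite {1}/Rintegral integral_poisson//= addrAC subrr sub0r normrN.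
apply: le_trans (le_normr_Rintegral _ iB) _ => //.
have -> : 2 / (T * w) = \int[mu]_(y in `[0, +oo[) (2 / w * expR (- (T * y))).
  rewrite RintegralZl//; last exact: integrable_expRM.
  by rewrite /Rintegral integral_expRM//=; field; rewrite !lt0r_neq0.
apply: le_Rintegral => //.
- exact: integrable_norm.
- by move=> y; rewrite /= in_itv /= andbT; exact: Ble.
Qed.

(** For [T w <= 1] the integrand bound gives 1; beyond, the sine integral is
    within 2 of [pi / 2 < 2]. *)
Lemma sine_integral_le4 (R : realType) (T w : R) : 0 <= T ->
  `|sine_integral T w| <= 4.
Proof.
move=> T0; wlog w0 : w / 0 <= w => [H|].
  have [/H//|w0] := leP 0 w.
  by rewrite -(opprK w) sine_integralN normrN H// oppr_ge0 ltW.
have [Tw|Tw] := leP (T * w) 1.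
  rewrite (le_trans (sine_integral_le _ T0))// (ger0_norm w0) (le_trans Tw)//.
  by rewrite ler1n.
have Tw0 : 0 < T * w by rewrite (lt_trans _ Tw).
have w_gt0 : 0 < w.
  by rewrite lt_neqAle w0 andbT; apply: contraTneq Tw0 => <-; rewrite mulr0 ltxx.
have T_gt0 : 0 < T by rewrite -(pmulr_lgt0 _ w_gt0).
have := sine_integral_dist T_gt0 w_gt0; have := pihalf_lt2 R; have := pihalf_ge1 R.
have : 2 / (T * w) <= 2 by rewrite ler_pdivrMr// ler_peMr// ltW.
move: (sine_integral T w) => S; rewrite ler_norml => ? ? ? /andP[? ?].
by rewrite ler_norml; apply/andP; split; lra.
Qed.

(** * The second mean value inequality *)

(** [W] stands for a total variation function of [f]. This inequality between
    increments is additive over adjacent intervals, passes to one-sided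
    limits, and is stable under removal of a jump. *)
Definition controls (R : realType) (W f : R -> R) (a b : R) : Prop :=
  forall c d, a <= c -> c <= d -> d <= b -> `|f d - f c| <= W d - W c.

(** Summed over [n] equal pieces, the hypothesis telescopes in [D] and [W] and
    has [K * (b - a) / n] in place of [K * (b - a)]; let [n] go to infinity. *)
Lemma telescope_bound (R : realType) (D W : R -> R) (a b K M : R) : a <= b ->
  (forall c d, a <= c -> c <= d -> d <= b ->
     `|D d - D c| <= (W d - W c) * (K * (d - c) + M)) ->
  `|D b - D a| <= (W b - W a) * M.
Proof.
move=> ab H.
have Hn (n : nat) : `|D b - D a| <= (W b - W a) * (K * ((b - a) / n.+1%:R) + M).
  pose h := (b - a) / n.+1%:R; pose x (k : nat) := a + k%:R * h.
  have h0 : 0 <= h by rewrite divr_ge0// subr_ge0.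
  have x0 : x 0%N = a by rewrite /x mul0r addr0.
  have xn : x n.+1 = b.
    by rewrite /x /h mulrCA divff ?mulr1 ?pnatr_eq0// addrC subrK.
  have step k : (k <= n.+1)%N ->
      `|D (x k) - D a| <= (W (x k) - W a) * (K * h + M).
    elim: k => [|k IH] kn; first by rewrite x0 !subrr normr0 mul0r.
    have -> : D (x k.+1) - D a = (D (x k.+1) - D (x k)) + (D (x k) - D a) by ring.
    have -> : W (x k.+1) - W a = (W (x k.+1) - W (x k)) + (W (x k) - W a) by ring.
    rewrite mulrDl (le_trans (ler_normD _ _))// lerD ?IH ?(ltnW kn)//.
    have xS : x k.+1 = x k + h by rewrite /x -natr1; ring.
    have hE : h = x k.+1 - x k by rewrite xS; ring.
    rewrite [X in K * X]hE; apply: H.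
    - by rewrite /x lerDl mulr_ge0.
    - by rewrite xS lerDl.
    - by rewrite -xn /x lerD2l ler_wpM2r// ler_nat.
  by have := step n.+1 (leqnn _); rewrite xn.
suff lim0 : (W b - W a) * (K * ((b - a) * harmonic n) + M) @[n --> \oo] -->
    (W b - W a) * (K * ((b - a) * 0) + M).
  suff : `|D b - D a| <= (W b - W a) * (K * ((b - a) * 0) + M).
    by rewrite !mulr0 add0r.
  by apply: (cvgr_to_ge lim0); apply: nearW => n; exact: Hn.
apply: cvgM; first exact: cvg_cst.
apply: cvgD; last exact: cvg_cst.
apply: cvgM; first exact: cvg_cst.
apply: cvgM; first exact: cvg_cst.
exact: cvg_harmonic.
Qed.

(** Integration by parts with an error term: over a short interval [[c, d]],
    replacing [f] by the constant [f c] in the integral of [f k] costs at most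
    [(W d - W c) * K * (d - c)], which [telescope_bound] makes negligible. *)
Lemma second_mean_value_le (R : realType) (f k Phi W : R -> R) (a b K M : R) :
  a <= b ->
  mu.-integrable `[a, b] (EFin \o k) ->
  mu.-integrable `[a, b] (EFin \o (fun t => f t * k t)) ->
  (forall t, a <= t <= b -> `|k t| <= K) ->
  (forall c d, a <= c -> c <= d -> d <= b ->
    \int[mu]_(t in `[c, d]) k t = Phi d - Phi c) ->
  (forall t, a <= t <= b -> `|Phi t| <= M) ->
  controls W f a b ->
  `|\int[mu]_(t in `[a, b]) (f t * k t)| <= M * (`|f a| + `|f b| + (W b - W a)).
Proof.
move=> ab ik ifk kK kPhi PhiM fW.
(* the remainder of an integration by parts from a to c, up to a constant *)
pose D c := \int[mu]_(t in `[a, c]) (f t * k t) - f c * Phi c.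
have DE c d : a <= c -> c <= d -> d <= b ->
    D d - D c =
    \int[mu]_(t in `[c, d]) ((f t - f c) * k t) - (f d - f c) * Phi d.
  move=> ac cd db; rewrite /D (Rintegral_itv_split ac cd); last first.
    exact: integrable_subitv ifk.
  have -> : \int[mu]_(t in `[c, d]) ((f t - f c) * k t) =
     \int[mu]_(t in `[c, d]) (f t * k t) - f c * \int[mu]_(t in `[c, d]) k t.
    have ik' := integrable_subitv ac db ik.
    rewrite -RintegralZl// -RintegralB//.
    - by apply: eq_Rintegral => t _; rewrite mulrBl.
    - exact: integrable_subitv ifk.
    - exact: (integrableZl _ (f c) ik').
  by rewrite kPhi//; ring.
have HD : `|D b - D a| <= (W b - W a) * M.
  apply: (@telescope_bound _ _ _ _ _ K) => // c d ac cd db; rewrite DE//.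
  rewrite (le_trans (ler_normB _ _))// mulrDr lerD//; last first.
    rewrite normrM ler_pM ?fW// PhiM// db (le_trans ac)//.
  rewrite mulrA; apply: Rintegral_itv_le => //.
    have -> : EFin \o (fun t => (f t - f c) * k t) =
        ((EFin \o (fun t => (f t * k t)%R)) \-
         (EFin \o (fun t => (f c * k t)%R)))%E.
      by apply/funext => t; rewrite /= -EFinB mulrBl.
    apply: integrableB => //; first exact: integrable_subitv ifk.
    exact: (integrableZl _ (f c) (integrable_subitv ac db ik)).
  move=> t; rewrite in_itv /= => /andP[ct td].
  rewrite normrM ler_pM//.
    have := fW c t ac ct (le_trans td db).
    have := fW t d (le_trans ac ct) td db.
    have := normr_ge0 (f d - f t); lra.
  by rewrite kK// (le_trans ac)//= (le_trans td).
have Da : D a = - (f a * Phi a) by rewrite /D set_itv1 Rintegral_set1 sub0r.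
have fM c : a <= c <= b -> `|f c * Phi c| <= `|f c| * M.
  by move=> acb; rewrite normrM ler_wpM2l// PhiM.
have -> : \int[mu]_(t in `[a, b]) (f t * k t) =
    D b - D a + f b * Phi b - f a * Phi a.
  by rewrite Da /D; ring.
have := fM a; have := fM b; rewrite !lexx ab /= => /(_ isT) Hb /(_ isT) Ha.
apply: le_trans (ler_normB _ _) _.
apply: le_trans (lerD (ler_normD _ _) (lexx _)) _.
lra.
Qed.

(** * Functions of bounded variation *)

(** A partition of [[a, b]] extends to one of the extended line by adding [a]
    and the point at infinity, which only adds nonnegative terms. *)
Lemma bounded_variation_bar_itv (R : realType) (f : R -> R) (a b : R) :
  bounded_variation_bar f -> bounded_variation a b f.
Proof.
move=> [M Mub]; exists M => _ [s [sp sl] <-].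
pose t := rcons [seq y%:E | y <- a :: s] +oo%E.
have tp : itv_partition -oo%E +oo%E t.
  split; last by rewrite /t last_rcons.
  rewrite /t rcons_path /= last_map ltry andbT ltNyr /=.
  by rewrite (homo_path (e := <%O)) //.
apply: (@le_trans _ _ (variation_bar f t)); last by apply: Mub; exists t.
rewrite /variation_bar /variation size_rcons size_map /=.
(* drop the first and the last terms, at the two infinities *)
rewrite big_nat_recr//= big_nat_recl//=.
apply: (@le_trans _ _ (\sum_(1 <= i < (size s).+1)
    `|ext_bar f (nth +oo%E t i) - ext_bar f (nth +oo%E (-oo%E :: t) i)|)).
  rewrite big_add1 /= le_eqVlt; apply/orP; left; apply/eqP.
  apply: eq_big_nat => i /andP[_ si].
  have tE k : (k < size (a :: s))%N -> nth +oo%E t k = (nth b (a :: s) k)%:E.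
    by move=> ks; rewrite /t nth_rcons size_map ks (nth_map b).
  have /= -> := tE i.+1 si; rewrite tE//=; exact: ltnW.
by rewrite -[leLHS]addr0 lerD// lerDr.
Qed.

Lemma bounded_variation_controls (R : realType) (f : R -> R) (a b : R) :
  a <= b -> bounded_variation a b f ->
  exists W : R -> R, controls W f a b.
Proof.
move=> ab bv; exists (fun u => fine (total_variation a u f)) => c d ac cd db.
have ad := le_trans ac cd; have cb := le_trans cd db.
have fin_d : total_variation a d f \is a fin_num.
  by apply/bounded_variationP => //; exact: bounded_variationl bv.
have := total_variation_ge f cd.
have := total_variationD f ac cd; move: fin_d => /[swap] -> .
rewrite fin_numD => /andP[fc fd].
rewrite fineD// addrAC subrr add0r -lee_fin fineK//.
Qed.

Lemma nondecreasing_cvg_right (R : realType) (f : R -> R) (a b x : R) :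
  a < x -> x < b ->
  {in `[a, b] &, nondecreasing_fun f} -> cvg (f t @[t --> x^'+]).
Proof.
move=> ax xb ndf; apply/cvg_ex; eexists.
apply: (@nondecreasing_at_right_cvgr _ f x (BRight b)); first by rewrite bnd_simp.
  move=> c d; rewrite !in_itv /= => /andP[xc cb] /andP[xd db] cd.
  by apply: ndf; rewrite // in_itv /= ?cb ?db ltW// (lt_trans ax).
exists (f x) => y [t /=]; rewrite in_itv /= => /andP[xt tb] <-.
by apply: ndf; rewrite ?in_itv /= ?(ltW ax) ?(ltW xb) ?tb ?ltW// (lt_trans ax).
Qed.

Lemma nondecreasing_cvg_left (R : realType) (f : R -> R) (a b x : R) :
  a < x -> x < b ->
  {in `[a, b] &, nondecreasing_fun f} -> cvg (f t @[t --> x^'-]).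
Proof.
move=> ax xb ndf.
suff /cvg_ex[l fl] : cvg ((\- (f \o -%R))%R t @[t --> (- x)^'+]).
  apply/cvg_ex; exists (- l); apply/cvg_at_leftNP.
  have -> : f \o -%R = \- (\- (f \o -%R))%R by apply/funext => t; rewrite /= opprK.
  exact: cvgN.
apply: (@nondecreasing_cvg_right _ _ (- b) (- a)); rewrite ?ltrN2//.
move=> c d; rewrite !in_itv /= => /andP[bc ca] /andP[bd da] cd.
rewrite lerN2; apply: ndf; rewrite ?in_itv /=; lra.
Qed.

Lemma controls_nondecreasing (R : realType) (f W : R -> R) (a b : R) :
  controls W f a b -> {in `[a, b] &, nondecreasing_fun W}.
Proof.
move=> fW c d; rewrite !in_itv /= => /andP[ac _] /andP[_ db] cd.
by rewrite -subr_ge0 (le_trans _ (fW _ _ ac cd db)).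
Qed.

Lemma controls_add_nondecreasing (R : realType) (f W : R -> R) (a b : R) :
  controls W f a b -> {in `[a, b] &, nondecreasing_fun (f \+ W)}.
Proof.
move=> fW c d; rewrite !in_itv /= => /andP[ac _] /andP[_ db] cd.
have := fW _ _ ac cd db; rewrite ler_norml /= => /andP[]; lra.
Qed.

(** [f] is the difference of the nondecreasing functions [f + W] and [W]. *)
Lemma controls_cvg_right (R : realType) (f W : R -> R) (a b x : R) :
  controls W f a b -> a < x -> x < b ->
  cvg (f t @[t --> x^'+]) /\ cvg (W t @[t --> x^'+]).
Proof.
move=> fW ax xb.
have cW := nondecreasing_cvg_right ax xb (controls_nondecreasing fW).
have cfW := nondecreasing_cvg_right ax xb (controls_add_nondecreasing fW).
split=> //; have -> : f = ((f \+ W) \- W)%R by apply/funext => t /=; rewrite addrK.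
exact: is_cvgB.
Qed.

Lemma controls_cvg_left (R : realType) (f W : R -> R) (a b x : R) :
  controls W f a b -> a < x -> x < b ->
  cvg (f t @[t --> x^'-]) /\ cvg (W t @[t --> x^'-]).
Proof.
move=> fW ax xb.
have cW := nondecreasing_cvg_left ax xb (controls_nondecreasing fW).
have cfW := nondecreasing_cvg_left ax xb (controls_add_nondecreasing fW).
split=> //; have -> : f = ((f \+ W) \- W)%R by apply/funext => t /=; rewrite addrK.
exact: is_cvgB.
Qed.

Lemma controls_limit_right (R : realType) (f W : R -> R) (a b x l w : R) :
  controls W f a b -> a <= x ->
  f t @[t --> x^'+] --> l -> W t @[t --> x^'+] --> w ->
  forall d, x < d -> d <= b -> `|f d - l| <= W d - w.
Proof.
move=> fW ax fl Ww d xd db.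
apply: (@ler_cvg_to _ (x^'+) _ _ (fun t => `|f d - f t|) (fun t => W d - W t)).
- by apply: cvg_norm; apply: cvgB => //; exact: cvg_cst.
- by apply: cvgB => //; exact: cvg_cst.
- near=> t; apply: fW => //.
    by rewrite (le_trans ax)//; near: t; exact: nbhs_right_ge.
  by near: t; apply: nbhs_right_le.
Unshelve. all: by end_near. Qed.

Lemma controls_limit_left (R : realType) (f W : R -> R) (a b x l w : R) :
  controls W f a b -> x <= b ->
  f t @[t --> x^'-] --> l -> W t @[t --> x^'-] --> w ->
  forall c, a <= c -> c < x -> `|l - f c| <= w - W c.
Proof.
move=> fW xb fl Ww c ac cx.
apply: (@ler_cvg_to _ (x^'-) _ _ (fun t => `|f t - f c|) (fun t => W t - W c)).
- by apply: cvg_norm; apply: cvgB => //; exact: cvg_cst.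
- by apply: cvgB => //; exact: cvg_cst.
- near=> t; apply: fW => //.
    by near: t; apply: nbhs_left_ge.
  by apply: le_trans xb; near: t; exact: nbhs_left_le.
Unshelve. all: by end_near. Qed.

(** The value 0 at [x] makes the result continuous at [x] when [l] and [r] are
    the one-sided limits of [f]. *)
Definition remove_jump (R : realType) (x l r : R) (f : R -> R) (t : R) : R :=
  if t < x then f t - l else if x < t then f t - r else 0.

Lemma remove_jumpx (R : realType) (x l r : R) (f : R -> R) :
  remove_jump x l r f x = 0.
Proof. by rewrite /remove_jump ltxx. Qed.

(** On one side of [x] increments are unchanged; across [x] the increment
    splits into two parts, each controlled by a one-sided limit of the
    hypothesis. *)
Lemma remove_jump_controls (R : realType) (f W : R -> R) (a b x fl fr wl wr : R) :
  controls W f a b -> a < x -> x < b ->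
  f t @[t --> x^'-] --> fl -> f t @[t --> x^'+] --> fr ->
  W t @[t --> x^'-] --> wl -> W t @[t --> x^'+] --> wr ->
  controls (remove_jump x wl wr W) (remove_jump x fl fr f) a b.
Proof.
move=> fW ax xb f_l f_r W_l W_r.
have Hr := controls_limit_right fW (ltW ax) f_r W_r.
have Hl := controls_limit_left fW (ltW xb) f_l W_l.
move=> c d ac cd db; rewrite /remove_jump.
case: (ltgtP d x) => [dx|xd|dx]; case: (ltgtP c x) => [cx|xc|cx]; try lra.
- have -> : f d - fl - (f c - fl) = f d - f c by ring.
  by have := fW c d ac cd db; lra.
- have := Hr d xd db; have := Hl c ac cx.
  have := ler_normD (f d - fr) (fl - f c).
  have -> : f d - fr + (fl - f c) = f d - fr - (f c - fl) by ring.
  lra.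
- have -> : f d - fr - (f c - fr) = f d - f c by ring.
  by have := fW c d ac cd db; lra.
- by have := Hr d xd db; rewrite !subr0.
- by have := Hl c ac cx; rewrite !sub0r !opprB.
- by rewrite !subr0 normr0.
Qed.

Lemma remove_jump_small_right (R : realType) (W : R -> R) (x l r b e : R) :
  W t @[t --> x^'+] --> r -> x < b -> 0 < e ->
  exists2 d, x < d <= b & remove_jump x l r W d <= e.
Proof.
move=> Wr xb e0; near x^'+ => d.
have xd : x < d by near: d; exact: nbhs_right_gt.
exists d; first by rewrite xd /=; near: d; exact: nbhs_right_le.
rewrite /remove_jump ltNge (ltW xd) /= xd; apply: le_trans (ler_norm _) _.
by near: d; move/cvgrPdistC_le : Wr; apply.
Unshelve. all: by end_near. Qed.

Lemma remove_jump_small_left (R : realType) (W : R -> R) (x l r a e : R) :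
  W t @[t --> x^'-] --> l -> a < x -> 0 < e ->
  exists2 c, a <= c < x & - remove_jump x l r W c <= e.
Proof.
move=> Wl ax e0; near x^'- => c.
have cx : c < x by near: c; exact: nbhs_left_lt.
exists c; first by rewrite cx andbT; near: c; exact: nbhs_left_ge.
rewrite /remove_jump cx opprB; apply: le_trans (ler_norm _) _.
by near: c; move/cvgrPdist_le : Wl; apply.
Unshelve. all: by end_near. Qed.

Definition jump (R : realType) (x l m r : R) (t : R) : R :=
  if t < x then l else if x < t then r else m.

Lemma remove_jumpE (R : realType) (x l r : R) (f : R -> R) (t : R) :
  remove_jump x l r f t = f t - jump x l (f x) r t.
Proof.
rewrite /remove_jump /jump; case: ltgtP => // ->; by rewrite subrr.
Qed.

Lemma integrable_jump (R : realType) (x l m r a b : R) :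
  mu.-integrable `[a, b] (EFin \o jump x l m r).
Proof.
apply: (bounded_integrable_itv (K := `|l| + `|m| + `|r|)
  (lebesgue_measure_itv_lty _ _ _ _)).
  apply: measurable_funTS; apply: measurable_fun_ifT => //.
    exact: measurable_fun_ltr.
  apply: measurable_fun_ifT => //; exact: measurable_fun_ltr.
move=> t _; rewrite /jump.
have := normr_ge0 l; have := normr_ge0 m; have := normr_ge0 r.
by case: ifP => _; [|case: ifP => _]; lra.
Qed.

(** * The Dirichlet-Jordan theorem for the Dirichlet kernel *)

(** Split at two points [c < x < d] between which [V] varies little. The
    antiderivatives in the second mean value inequality are [Si] in the
    middle and [Si + pi / 2], [Si - pi / 2] on the left and on the right: the
    last two are at most [2 / (T r)], where [r] is the distance from [x] to
    the nearer of [c] and [d]. *)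
Lemma kernel_integral_small (R : realType) (h V : R -> R) (a b x e : R) :
  a < x -> x < b -> mu.-integrable `[a, b] (EFin \o h) ->
  controls V h a b -> h x = 0 -> V x = 0 ->
  (forall e, 0 < e -> exists2 c, a <= c < x & - V c <= e) ->
  (forall e, 0 < e -> exists2 d, x < d <= b & V d <= e) ->
  0 < e ->
  \forall T \near +oo,
    `|\int[mu]_(t in `[a, b]) (h t * dirichlet_kernel T (t - x))| <= e.
Proof.
move=> ax xb ih hV hx Vx smallL smallR e0.
(* The middle piece is at most 4 * (1 + 1 + 2) * (e / 32) = e / 2. *)
have e'0 : 0 < e / 32 by rewrite divr_gt0.
have [c /andP[ac cx] Vc] := smallL _ e'0.
have [d /andP[xd db] Vd] := smallR _ e'0.
have hl t : a <= t -> t <= x -> `|h t| <= - V t.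
  by move=> at_ tx; have := hV t x at_ tx (ltW xb); rewrite hx Vx !sub0r normrN.
have hr t : x <= t -> t <= b -> `|h t| <= V t.
  by move=> xt tb; have := hV x t (ltW ax) xt tb; rewrite hx Vx !subr0.
have cd : c <= d by rewrite ltW// (lt_trans cx).
have cb := le_trans cd db.
have ad := le_trans ac cd.
pose r := Num.min (x - c) (d - x).
have r0 : 0 < r by rewrite lt_min !subr_gt0 cx.
near=> T.
have T0 : 0 < T by near: T; exact: nbhs_pinfty_gt.
have T0' := ltW T0.
have ihk := integrable_mul_dirichlet_kernel x T0' (measurable_itv _) ih.
rewrite (Rintegral_itv_split ac cb)// (Rintegral_itv_split cd db); last first.
  exact: integrable_subitv ihk.
pose M := 2 / (T * r).
have sub c' d' : a <= c' -> d' <= b -> controls V h c' d'.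
  move=> ac' db' c0 d0 cc0 c0d0 dd0; apply: hV => //.
    exact: le_trans cc0.
  exact: le_trans db'.
have HL : `|\int[mu]_(t in `[a, c]) (h t * dirichlet_kernel T (t - x))| <=
    M * (`|h a| + `|h c| + (V c - V a)).
  apply: (@second_mean_value_le _ _ _
    (fun t => sine_integral T (t - x) + pi / 2) _ _ _ T) => //.
  - exact: integrable_dirichlet_kernel.
  - exact: integrable_subitv ihk.
  - by move=> t _; exact: dirichlet_kernel_le.
  - by move=> c' d' ? ? ?; rewrite Rintegral_dirichlet_kernel//; ring.
  - move=> t /andP[_ tc].
    have xt : 0 < x - t by rewrite subr_gt0 (le_lt_trans tc).
    rewrite -[t - x]opprB sine_integralN -normrN opprD opprK.
    apply: le_trans (sine_integral_dist T0 xt) _.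
    rewrite ler_pM2l// lef_pV2 ?posrE ?mulr_gt0// ler_pM2l// ge_min.
    by apply/orP; left; rewrite lerB.
  - exact: sub.
have HR : `|\int[mu]_(t in `[d, b]) (h t * dirichlet_kernel T (t - x))| <=
    M * (`|h d| + `|h b| + (V b - V d)).
  apply: (@second_mean_value_le _ _ _
    (fun t => sine_integral T (t - x) - pi / 2) _ _ _ T) => //.
  - exact: integrable_dirichlet_kernel.
  - exact: integrable_subitv ihk.
  - by move=> t _; exact: dirichlet_kernel_le.
  - by move=> c' d' ? ? ?; rewrite Rintegral_dirichlet_kernel//; ring.
  - move=> t /andP[dt _].
    have xt : 0 < t - x by rewrite subr_gt0 (lt_le_trans xd).
    apply: le_trans (sine_integral_dist T0 xt) _.
    rewrite ler_pM2l// lef_pV2 ?posrE ?mulr_gt0// ler_pM2l// ge_min.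
    by apply/orP; right; rewrite lerB.
  - exact: sub.
have HC : `|\int[mu]_(t in `[c, d]) (h t * dirichlet_kernel T (t - x))| <=
    4 * (`|h c| + `|h d| + (V d - V c)).
  apply: (@second_mean_value_le _ _ _
    (fun t => sine_integral T (t - x)) _ _ _ T) => //.
  - exact: integrable_dirichlet_kernel.
  - exact: integrable_subitv ihk.
  - by move=> t _; exact: dirichlet_kernel_le.
  - by move=> c' d' ? ? ?; rewrite Rintegral_dirichlet_kernel.
  - by move=> t _; exact: sine_integral_le4.
  - exact: sub.
have hc := hl c ac (ltW cx); have hd := hr d (ltW xd) db.
have ha := hl a (lexx _) (ltW ax); have hb := hr b (ltW xb) (lexx _).
have M0 : 0 <= M by rewrite divr_ge0// mulr_ge0// ltW.
have HL' : M * (`|h a| + `|h c| + (V c - V a)) <= M * (- 2 * V a).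
  by rewrite ler_wpM2l//; lra.
have HR' : M * (`|h d| + `|h b| + (V b - V d)) <= M * (2 * V b).
  by rewrite ler_wpM2l//; lra.
have HM : M * (- 2 * V a) + M * (2 * V b) <= e / 2.
  rewrite -mulrDr /M mulrAC ler_pdivrMr ?mulr_gt0// [T * r]mulrC mulrA.
  by rewrite -ler_pdivrMl ?mulr_gt0 ?divr_gt0.
apply: le_trans (ler_normD _ _) _.
apply: le_trans (lerD (lexx _) (ler_normD _ _)) _.
lra.
Unshelve. all: by end_near. Qed.

(** The kernel is even with antiderivative [Si] vanishing at the origin, so
    each half of the interval carries [sine_integral T A]. *)
Lemma Rintegral_jump_kernel (R : realType) (T x l m r A : R) :
  0 <= T -> 0 < A ->
  \int[mu]_(t in `[x - A, x + A])
    (jump x l m r t * dirichlet_kernel T (t - x)) =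
  (l + r) * sine_integral T A.
Proof.
move=> T0 A0.
have ij := integrable_mul_dirichlet_kernel x T0 (measurable_itv _)
  (integrable_jump x l m r (x - A) (x + A)).
have xA : x - A <= x by rewrite gerBl ltW.
have xA' : x <= x + A by rewrite lerDl ltW.
rewrite (Rintegral_itv_split xA xA')// mulrDl.
have S0 : sine_integral T 0 = 0.
  rewrite /sine_integral; under eq_Rintegral do rewrite mulr0 sin0 mul0r.
  by rewrite Rintegral_cst// mul0r.
have kl : \int[mu]_(t in `[x - A, x]) dirichlet_kernel T (t - x) =
    sine_integral T A.
  rewrite Rintegral_dirichlet_kernel// subrr addrAC subrr sub0r sine_integralN.
  by rewrite S0 opprK add0r.
have kr : \int[mu]_(t in `[x, x + A]) dirichlet_kernel T (t - x) =
    sine_integral T A.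
  by rewrite Rintegral_dirichlet_kernel// subrr addrAC subrr add0r S0 subr0.
congr (_ + _).
- rewrite -kl -RintegralZl//; last exact: integrable_dirichlet_kernel.
  rewrite -[LHS]Rintegral_itv_bndo_bndc; last first.
    apply: integrableS ij => //.
    by apply: subset_itv; rewrite bnd_simp.
  rewrite -[RHS]Rintegral_itv_bndo_bndc; last first.
    apply: integrableS
      (integrableZl _ l (integrable_dirichlet_kernel x (x - A) x T0)) => //.
    exact: subset_itv_co_cc.
  apply: eq_Rintegral => t; rewrite inE /= in_itv /= => /andP[_ tx].
  by rewrite /jump tx.
- rewrite -kr -RintegralZl//; last exact: integrable_dirichlet_kernel.
  rewrite -[LHS]Rintegral_itv_obnd_cbnd; last first.
    apply: integrableS ij => //.
    by apply: subset_itv; rewrite bnd_simp.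
  rewrite -[RHS]Rintegral_itv_obnd_cbnd; last first.
    apply: integrableS
      (integrableZl _ r (integrable_dirichlet_kernel x x (x + A) T0)) => //.
    exact: subset_itv_oc_cc.
  apply: eq_Rintegral => t; rewrite inE /= in_itv /= => /andP[xt _].
  by rewrite /jump ltNge (ltW xt) /= xt.
Qed.

(** At distance at least [A] from [x] the kernel is at most [A^-1], whatever
    [T] is. *)
Lemma Rintegral_kernel_tail (R : realType) (f : R -> R) (T x A : R) :
  0 <= T -> 0 < A ->
  mu.-integrable setT (EFin \o f) ->
  `|\int[mu]_t (f t * dirichlet_kernel T (t - x)) -
    \int[mu]_(t in `[x - A, x + A]) (f t * dirichlet_kernel T (t - x))|
  <= (\int[mu]_t `|f t|) / A.
Proof.
move=> T0 A0 intf.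
set D := `[x - A, x + A]%classic.
have mD : measurable D by exact: measurable_itv.
have mD' := measurableC mD.
have disj : [disjoint D & ~` D] by apply/disj_setPS; rewrite setICr.
have split_D (g : R -> R) : mu.-integrable setT (EFin \o g) ->
    \int[mu]_t g t = \int[mu]_(t in D) g t + \int[mu]_(t in ~` D) g t.
  by move=> ig; rewrite -[in LHS](setUv D) Rintegral_setU// setUv.
have ifk := integrable_mul_dirichlet_kernel x T0 measurableT intf.
rewrite split_D// addrAC subrr add0r.
have ifk' : mu.-integrable (~` D)
    (EFin \o (fun t => f t * dirichlet_kernel T (t - x))).
  exact: integrableS ifk.
have intf' : mu.-integrable (~` D) (EFin \o (fun t => `|f t|)).
  by apply: integrableS (integrable_norm intf).
apply: le_trans (le_normr_Rintegral _ ifk') _ => //.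
apply: (@le_trans _ _ (\int[mu]_(t in ~` D) (`|f t| * A^-1))).
  apply: le_Rintegral => //.
  - exact: integrable_norm.
  - exact: (integrableZr _ A^-1 intf').
  - move=> t Dt; rewrite normrM ler_wpM2l//.
    have At : A <= `|t - x|.
      rewrite leNgt; apply/negP; rewrite ltr_distlC => /andP[? ?]; apply: Dt.
      rewrite /D /= in_itv /=; apply/andP; split; lra.
    have t0 : t - x != 0 by rewrite -normr_gt0 (lt_le_trans A0).
    apply: le_trans (dirichlet_kernel_decay T0 t0) _.
    by rewrite lef_pV2// posrE// (lt_le_trans A0).
rewrite RintegralZr// ler_wpM2r ?invr_ge0 ?(ltW A0)//.
rewrite (split_D (fun t => `|f t|)); last exact: integrable_norm.
by rewrite lerDr Rintegral_ge0.
Qed.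

(** Cut at distance [A] from [x] and remove the jump: the tail, the remainder
    and the error of the sine integral each weigh at most a quarter of [e],
    the first through the choice of [A] and the other two for large [T]. *)
Lemma dirichlet_jordan (R : realType) (f : R -> R) (x fl fr : R) :
  mu.-integrable setT (EFin \o f) ->
  (forall a b, a <= b -> exists W, controls W f a b) ->
  f t @[t --> x^'-] --> fl -> f t @[t --> x^'+] --> fr ->
  \int[mu]_t (f t * dirichlet_kernel T (t - x)) @[T --> +oo] -->
    (fl + fr) * (pi / 2).
Proof.
move=> intf bvf f_l f_r; apply/cvgrPdist_le => e e0.
pose N := \int[mu]_t `|f t|.
have N0 : 0 <= N by exact: Rintegral_ge0.
(* N / A <= e / 4; the 1 keeps A positive when N = 0 *)
pose A := 4 * N / e + 1.
have A0 : 0 < A by rewrite ltr_wpDl// divr_ge0 ?mulr_ge0// ltW.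
have NA : N / A <= e / 4.
  rewrite ler_pdivrMr// /A mulrDr mulr1.
  have -> : e / 4 * (4 * N / e) = N by field; rewrite lt0r_neq0.
  by rewrite lerDl divr_ge0// ltW.
have ax : x - A < x by rewrite gtrBl.
have xb : x < x + A by rewrite ltrDl.
have [W fW] := bvf _ _ (ltW (lt_trans ax xb)).
have [_ /cvg_ex[wl W_l]] := controls_cvg_left fW ax xb.
have [_ /cvg_ex[wr W_r]] := controls_cvg_right fW ax xb.
have intfab : mu.-integrable `[x - A, x + A] (EFin \o f).
  exact: integrableS intf.
have ij := integrable_jump x fl (f x) fr (x - A) (x + A).
have ih : mu.-integrable `[x - A, x + A] (EFin \o remove_jump x fl fr f).
  have -> : EFin \o remove_jump x fl fr f =
      ((EFin \o f) \- (EFin \o jump x fl (f x) fr))%E.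
    by apply/funext => t; rewrite /= remove_jumpE EFinB.
  exact: integrableB.
have e4 : 0 < e / 4 by rewrite divr_gt0.
have small := @kernel_integral_small _ _ _ _ _ _ (e / 4) ax xb ih
  (remove_jump_controls fW ax xb f_l f_r W_l W_r)
  (remove_jumpx _ _ _ _) (remove_jumpx _ _ _ _)
  (fun e' e'0 => remove_jump_small_left _ W_l ax e'0)
  (fun e' e'0 => remove_jump_small_right _ W_r xb e'0) e4.
near=> T.
have T0 : 0 < T by near: T; exact: nbhs_pinfty_gt.
have T0' := ltW T0.
have tail := Rintegral_kernel_tail x T0' A0 intf.
have hsmall : `|\int[mu]_(t in `[x - A, x + A])
    (remove_jump x fl fr f t * dirichlet_kernel T (t - x))| <= e / 4 by near: T.
have jumpE := Rintegral_jump_kernel x fl (f x) fr T0' A0.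
have dist : `|(fl + fr) * (sine_integral T A - pi / 2)| <= e / 4.
  rewrite normrM.
  apply: le_trans (ler_wpM2l (normr_ge0 _) (sine_integral_dist T0 A0)) _.
  rewrite mulrA ler_pdivrMr ?mulr_gt0// [T * A]mulrC mulrA.
  by rewrite -ler_pdivrMl ?mulr_gt0.
have splitE : \int[mu]_(t in `[x - A, x + A]) (f t * dirichlet_kernel T (t - x)) =
   \int[mu]_(t in `[x - A, x + A])
     (remove_jump x fl fr f t * dirichlet_kernel T (t - x)) +
   \int[mu]_(t in `[x - A, x + A])
     (jump x fl (f x) fr t * dirichlet_kernel T (t - x)).
  rewrite -RintegralD//; [|exact: integrable_mul_dirichlet_kernel..].
  by apply: eq_Rintegral => t _; rewrite remove_jumpE mulrBl subrK.
move: tail; rewrite splitE jumpE -/N.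
move: hsmall; set I1 := \int[mu]_(t in `[x - A, x + A]) _.
set I := \int[mu]_t _ => hsmall tail.
have -> : (fl + fr) * (pi / 2) - I =
  - (I - (I1 + (fl + fr) * sine_integral T A)) - I1
  - (fl + fr) * (sine_integral T A - pi / 2) by ring.
apply: le_trans (ler_normB _ _) _.
apply: le_trans (lerD (ler_normB _ _) (lexx _)) _.
rewrite normrN; lra.
Unshelve. all: by end_near. Qed.

(** * Fourier inversion *)

Lemma integrable_mul_trig (R : realType) (c f : R -> R) (s x : R) :
  continuous c -> (forall u, `|c u| <= 1) -> mu.-integrable setT (EFin \o f) ->
  mu.-integrable setT (EFin \o (fun t => f t * c (s * (t - x)))).
Proof.
move=> cc c1 fi; apply: (@integrableMl _ _ _ mu setT measurableT (EFin \o f) _ fi).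
  apply: (measurableT_comp (continuous_measurable_fun cc)).
  by apply: measurable_funM => //; exact: measurable_funB.
exists 1; split; first exact: num_real.
by move=> M /ltW M1 t _ /=; rewrite (le_trans (c1 _)).
Qed.

Lemma Rintegral_Fubini_trig (R : realType) (c f : R -> R) (x T : R) :
  continuous c -> (forall u, `|c u| <= 1) -> mu.-integrable setT (EFin \o f) ->
  \int[mu]_(s in `[- T, T]) \int[mu]_t (f t * c (s * (t - x))) =
  \int[mu]_t (f t * \int[mu]_(s in `[- T, T]) c (s * (t - x))).
Proof.
move=> cc c1 fi.
have mf : measurable_fun setT f.
  by apply/measurable_EFinP; exact: (measurable_int mu).
rewrite (@Rintegral_Fubini _ _ _ _ _ mu mu _ _ (fun s t => f t * c (s * (t - x)))
  (cst (\int[mu]_t `|f t|)))//.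
- apply: eq_Rintegral => t _; rewrite RintegralZl//.
  apply: (bounded_integrable_itv (K := 1)
    (lebesgue_measure_itv_lty _ _ _ _)) => //.
  apply: measurable_funTS.
  apply: (measurableT_comp (continuous_measurable_fun cc)).
  exact: measurable_funM.
- apply: measurable_funM.
    by apply: (measurableT_comp mf).
  apply: (measurableT_comp (continuous_measurable_fun cc)).
  by apply: measurable_funM => //; apply: measurable_funB.
- by apply: continuous_integrable_itv => ?; exact: cvg_cst.
- move=> s _; rewrite /= /Rintegral fineK.
    apply: ge0_le_integral => //.
    + exact: (measurable_int mu
        (integrable_norm (integrable_mul_trig s x cc c1 fi))).
    + exact: (measurable_int mu (integrable_norm fi)).
    + by move=> t _; rewrite lee_fin normrM ler_piMr.
  by apply: integrable_fin_num => //; exact: (integrable_norm fi).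
Qed.

(** The integrand is the transform of [f] against [expi (s * (x - t))]; after
    exchanging the integrals, the cosine gives the kernel and the sine
    integrates to 0 over a symmetric interval. *)
Lemma fourier_partialE (R : realType) (f : R -> R) (x T : R) : 0 <= T ->
  mu.-integrable setT (EFin \o f) ->
  fourier_partial f x T =
  (2 * \int[mu]_t (f t * dirichlet_kernel T (t - x)))%:C.
Proof.
move=> T0 fi.
have icos s := integrable_mul_trig s 0 (@continuous_cos R) (@cos_max R) fi.
have isin s := integrable_mul_trig s 0 (@continuous_sin R) (@sin_max R) fi.
pose P s := \int[mu]_t (f t * cos (s * (t - 0))).
pose Q s := \int[mu]_t (f t * sin (s * (t - 0))).
have FE s : fourier f s = P s +i* (- Q s).
  rewrite /fourier /cintegral; congr (_ +i* _).
    by apply: eq_Rintegral => t _ /=; rewrite cosN subr0 mulr0 subr0 mulrC.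
  rewrite -mulN1r -RintegralZl//.
  by apply: eq_Rintegral => t _ /=; rewrite sinN subr0; ring.
have ReE s : \int[mu]_t (f t * cos (s * (t - x))) =
    cos (x * s) * P s + sin (x * s) * Q s.
  rewrite -!RintegralZl// -RintegralD//.
  - apply: eq_Rintegral => t _; rewrite mulrBr cosB subr0 [s * x]mulrC; ring.
  - exact: (integrableZl _ (cos (x * s)) (icos s)).
  - exact: (integrableZl _ (sin (x * s)) (isin s)).
have ImE s : \int[mu]_t (f t * sin (- (s * (t - x)))) =
    sin (x * s) * P s - cos (x * s) * Q s.
  rewrite -!RintegralZl// -RintegralB//.
  - apply: eq_Rintegral => t _.
    rewrite sinN mulrBr sinB subr0 [s * x]mulrC; ring.
  - exact: (integrableZl _ (sin (x * s)) (icos s)).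
  - exact: (integrableZl _ (cos (x * s)) (isin s)).
rewrite /fourier_partial /cintegral.
transitivity ((\int[mu]_(s in `[- T, T]) \int[mu]_t (f t * cos (s * (t - x)))) +i*
   (\int[mu]_(s in `[- T, T]) \int[mu]_t (f t * sin (- (s * (t - x)))))).
  congr (_ +i* _); apply: eq_Rintegral => s _; rewrite FE /=.
    by rewrite ReE; ring.
  by rewrite ImE; ring.
congr (_ +i* _).
  rewrite Rintegral_Fubini_trig//; [|exact: continuous_cos|exact: cos_max].
  rewrite -RintegralZl//; last exact: integrable_mul_dirichlet_kernel.
  by apply: eq_Rintegral => t _; rewrite dirichlet_kernel_sym//; ring.
rewrite (@Rintegral_Fubini_trig _ (fun u => sin (- u)))//.
- transitivity (\int[lebesgue_measure]_(t in [set: R]) (0 : R)).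
    apply: eq_Rintegral => t _.
    under eq_Rintegral do rewrite -mulrN.
    by rewrite Rintegral_sin_sym// mulr0.
  by rewrite Rintegral_cst// mul0r.
- move=> u; apply: (@continuous_comp _ _ _ -%R sin).
    exact: opp_continuous.
  exact: continuous_sin.
- by move=> u; exact: sin_max.
Qed.

Lemma cvg_real_complex (R : realType) (F : set_system R) (FF : Filter F)
    (g : R -> R) (l : R) :
  g t @[t --> F] --> l ->
  ((g t)%:C : R[i]^o) @[t --> F] --> (l%:C : R[i]^o).
Proof.
move=> /cvgrPdist_le gl; apply/cvgrPdist_le => -[e e'].
rewrite ltcE /= => /andP[/eqP -> e0].
apply: filterS (gl e e0) => t te.
rewrite -rmorphB /= normc_def /= expr0n addr0 sqrtr_sqr.
by rewrite lecE /= eqxx.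
Qed.

Unset Implicit Arguments.

Theorem theorem3p1 (R : realType) (f : R -> R)
    (f_bv : bounded_variation_bar f)
    (f_L1 : lebesgue_measure.-integrable setT (fun t : R => (f t)%:E)) :
  forall x : R,
  [/\ cvg (f t @[t --> x^'-]),
      cvg (f t @[t --> x^'+]),
      cvg (fourier_partial f x T @[T --> +oo]) &
      ((lim (f t @[t --> x^'-]) + lim (f t @[t --> x^'+])) / 2)%:C
      = ((2 * pi)^-1)%:C * lim (fourier_partial f x T @[T --> +oo])].
Proof.
move=> x.
have ctrl a b : a <= b -> exists W, controls W f a b.
  move=> ab; apply: bounded_variation_controls => //.
  exact: bounded_variation_bar_itv.
have ax : x - 1 < x by lra.
have xb : x < x + 1 by lra.
have [W fW] := ctrl _ _ (ltW (lt_trans ax xb)).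
have [cl _] := controls_cvg_left fW ax xb.
have [cr _] := controls_cvg_right fW ax xb.
set fl := lim (f t @[t --> x^'-]); set fr := lim (f t @[t --> x^'+]).
have lim_partial : fourier_partial f x T @[T --> +oo] -->
    ((pi * (fl + fr))%:C : R[i]^o).
  have lim_real :
      2 * \int[mu]_t (f t * dirichlet_kernel T (t - x)) @[T --> +oo] -->
      pi * (fl + fr).
    rewrite (_ : pi * (fl + fr) = 2 * ((fl + fr) * (pi / 2))); last by field.
    by apply: cvgM; [exact: cvg_cst|exact: dirichlet_jordan].
  apply: cvg_trans (cvg_real_complex _ lim_real).
  apply: near_eq_cvg; near=> T; rewrite fourier_partialE//.
split; [exact: cl|exact: cr|by apply/cvg_ex; eexists; exact: lim_partial|].
rewrite (cvg_lim _ lim_partial)//.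
rewrite -rmorphM /=; congr (_%:C).
(* [field] would unfold the definition of pi *)
by have := lt0r_neq0 (pi_gt0 R); move: (@pi R) => p p0; field.
Unshelve. all: by end_near. Qed.
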